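(* Let $n\ge 1$. (I) Let $R=(r_1,\dots,r_n)$ and $S=(s_1,\dots,s_n)$ be vectors of nonnegative real numbers with $\sum_i r_i=\sum_j s_j$. Then $\mathcal{T}^{\pi/2}(R,S)\neq\emptyset$ if and only if (a) $R=S$, and (b) $R$ is palindromic, i.e. $r_i=r_{n+1-i}$ for all $i$. (II) Suppose in addition that $R$ and $S$ have nonnegative integer components. Then $\mathcal{T}^{\pi/2}_{\mathbb{Z}}(R,S)\neq\emptyset$ if and only if (a) and (b) hold as well as at least one of (c) $r_1+r_2+\dots+r_{\lfloor n/2\rfloor}$ is even, or (d) $n$ is odd and $r_{\lceil n/2\rceil}\ge 2$.
   Context: $\mathcal{T}(R,S)$ is the set of $n\times n$ matrices with nonnegative real entries whose $i$th row sum is $r_i$ and whose $j$th column sum is $s_j$ for all $i,j$. The counterclockwise rotation $\rho_{\pi/2}$ by $\pi/2$ acts on $n\times n$ matrices by $(\rho_{\pi/2}A)_{i,j}=a_{j,\,n+1-i}$. $\mathcal{T}^{\pi/2}(R,S)$ is the set of $A\in\mathcal{T}(R,S)$ with $\rho_{\pi/2}A=A$ (equivalently, invariant under the cyclic group generated by $\rho_{\pi/2}$); $\mathcal{T}^{\pi/2}_{\mathbb{Z}}(R,S)$ is the set of those $A\in\mathcal{T}^{\pi/2}(R,S)$ all of whose entries are integers. *)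

(* Defs.v *)
From HB Require Import structures.
From mathcomp Require Import all_boot all_order all_algebra.
From mathcomp Require Import all_classical all_reals.
Set Implicit Arguments.
Unset Strict Implicit.
Unset Printing Implicit Defensive.
Import Order.TTheory GRing.Theory Num.Theory.
Local Open Scope classical_set_scope.
Local Open Scope ring_scope.

(* Indices run over {0, ..., n-1}, so that the reflection i |-> n + 1 - i of
   {1, ..., n} is rev_ord. *)

Definition rot90 (K : realType) (n : nat) (A : 'M[K]_n) : 'M[K]_n :=
  \matrix_(i, j) A j (rev_ord i).

Definition transport (K : realType) (n : nat) (r s : 'rV[K]_n) : set 'M[K]_n :=
  [set A | [/\ forall i j, 0 <= A i j,
               forall i, \sum_j A i j = r 0 i
             & forall j, \sum_i A i j = s 0 j]].

Definition transport_rot (K : realType) (n : nat) (r s : 'rV[K]_n) :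
    set 'M[K]_n :=
  [set A | transport r s A /\ rot90 A = A].

Definition transport_rot_int (K : realType) (n : nat) (r s : 'rV[K]_n) :
    set 'M[K]_n :=
  [set A | transport_rot r s A /\ forall i j, A i j \is a Num.int].

Definition palindromic (K : realType) (n : nat) (r : 'rV[K]_n) : Prop :=
  forall i, r 0 i = r 0 (rev_ord i).

Definition is_even (K : realType) (x : K) : Prop :=
  exists m : int, x = (2 * m)%:~R.

(* Main.v *)
(** A rotation-invariant matrix has equal [i]-th row, [i]-th column and
    [(n+1-i)]-th row sums.  Conversely, splitting each [r_i] evenly between the
    diagonal and the antidiagonal gives a real solution.

    For integers, let [c] be the middle index when [n] is odd.  Counted by
    quadrants, the sum of the first [n/2] rows is twice a quadrant plus the
    upper part [t] of column [c], while [r_c] is at least [2 t]: so either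
    [t = 0] and the sum is even, or [t >= 1] and [r_c >= 2].  Conversely, the
    orbit of the position [(x, y)] has row sums
    [e_x + e_(n+1-x) + e_y + e_(n+1-y)].  Listing every [i <= n/2] with
    multiplicity [r_i] and adding up the orbits of consecutive pairs of the
    list produces [R], up to the entry at [(c, c)]; if the list has odd length,
    [c] is added to it, at the cost of [2] units of [r_c]. *)

Require Import Defs.
From HB Require Import structures.
From mathcomp Require Import all_boot all_order all_algebra.
From mathcomp Require Import all_classical all_reals.
From mathcomp Require Import zify lra.
Import Order.TTheory GRing.Theory Num.Theory.
Local Open Scope classical_set_scope.
Local Open Scope ring_scope.
Set Implicit Arguments.
Unset Strict Implicit.
Unset Printing Implicit Defensive.

(** Both parities of [n] are handled at once: the last sum is empty for even [n] and has the middle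
    index as its only term for odd [n]. *)
Lemma sum_rev_split (V : nmodType) (n : nat) (F : 'I_n -> V) :
  \sum_i F i = \sum_(i < n | (i < n./2)%N) (F i + F (rev_ord i))
               + \sum_(i | rev_ord i == i) F i.
Proof.
rewrite big_split /= (bigID (fun i : 'I_n => (i < n./2)%N)) /= -addrA.
congr (_ + _); rewrite (bigID (fun i : 'I_n => rev_ord i == i)) /= addrC.
congr (_ + _).
- rewrite (reindex_inj rev_ord_inj) /=; apply: eq_bigl => i.
  by rewrite -!val_eqE /=; have := ltn_ord i; lia.
- apply: eq_bigl => i; rewrite -!val_eqE /=; have := ltn_ord i; lia.
Qed.

Lemma rev_ord_fixedE (n : nat) (c : 'I_n) :
  (rev_ord c == c) = odd n && (c.+1 == uphalf n).
Proof. by rewrite -val_eqE /=; have := ltn_ord c; lia. Qed.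

Lemma rev_ord_fixed_unique (n : nat) (c i : 'I_n) :
  rev_ord c == c -> (rev_ord i == i) = (i == c).
Proof. by rewrite !rev_ord_fixedE -val_eqE /=; lia. Qed.

Section RotationInvariant.
Variables (K : realType) (n : nat).
Implicit Types (A : 'M[K]_n) (r : 'rV[K]_n) (x y c : 'I_n).

Lemma rot90_fixedE A i j : rot90 A = A -> A j (rev_ord i) = A i j.
Proof. by move/matrixP/(_ i j); rewrite mxE. Qed.

Lemma rot90_col_sum A j : rot90 A = A -> \sum_i A i j = \sum_i A j i.
Proof.
move=> rA; rewrite [RHS](reindex_inj rev_ord_inj).
by apply: eq_bigr => i _; rewrite rot90_fixedE.
Qed.

Lemma rot90_row_sum_rev A i :
  rot90 A = A -> \sum_j A (rev_ord i) j = \sum_j A i j.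
Proof.
move=> rA; rewrite (reindex_inj rev_ord_inj).
by apply: eq_bigr => j _; rewrite !rot90_fixedE.
Qed.

Lemma rot90D A B : rot90 (A + B) = rot90 A + rot90 B.
Proof. by apply/matrixP=> i j; rewrite !mxE. Qed.

Lemma rot90_delta x y : rot90 (delta_mx x y : 'M[K]_n) = delta_mx (rev_ord y) x.
Proof.
apply/matrixP=> i j; rewrite !mxE.
by rewrite -(inj_eq rev_ord_inj i) rev_ordK andbC.
Qed.

Lemma delta_row_sum x y i :
  \sum_j (delta_mx x y : 'M[K]_n) i j = (delta_mx 0 x : 'rV[K]_n) 0 i.
Proof.
rewrite (bigD1 y) //= big1 ?addr0 => [|j /negPf jy]; rewrite !mxE ?jy ?andbF //.
by rewrite !eqxx andbT.
Qed.

(** Natural entries carry nonnegativity and integrality together; the column sums come from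
    [rot90_col_sum]. *)
Definition rot_realizable r : Prop :=
  exists A, [/\ forall i j, A i j \is a Num.nat,
                forall i, \sum_j A i j = r 0 i & rot90 A = A].

Lemma rot_realizable0 : rot_realizable 0.
Proof.
exists 0; split=> [i j|i|]; first by rewrite mxE.
- by rewrite mxE big1 // => j _; rewrite mxE.
- by apply/matrixP=> i j; rewrite !mxE.
Qed.

Lemma rot_realizableD r s :
  rot_realizable r -> rot_realizable s -> rot_realizable (r + s).
Proof.
move=> [A [An Ar rA]] [B [Bn Bs rB]]; exists (A + B); split=> [i j|i|].
- by rewrite mxE rpredD.
- by rewrite mxE -Ar -Bs -big_split; apply: eq_bigr => j _; rewrite mxE.
- by rewrite rot90D rA rB.
Qed.

(** The four positions are the successive rotations of [(x, y)]. They are added with multiplicity,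
    so a degenerate orbit, such as that of the centre, needs no separate case. *)
Lemma rot_realizable_orbit x y :
  rot_realizable (delta_mx 0 x + delta_mx 0 (rev_ord x)
                  + (delta_mx 0 y + delta_mx 0 (rev_ord y))).
Proof.
exists (delta_mx x y + delta_mx (rev_ord y) x
        + delta_mx (rev_ord x) (rev_ord y) + delta_mx y (rev_ord x)).
split=> [i j|i|].
- by rewrite !mxE !rpredD ?natr_nat.
- under eq_bigr => j _ do
    rewrite [fun_of_matrix _ _ _]mxE [X in X + _]mxE [X in X + _ + _]mxE.
  rewrite !big_split /= !delta_row_sum !mxE.
  lra.
- rewrite !rot90D !rot90_delta !rev_ordK.
  by rewrite addrC !addrA.
Qed.

Lemma rot_realizable_center c (k : nat) :
  rev_ord c == c -> rot_realizable (k%:R *: delta_mx 0 c).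
Proof.
move=> /eqP cc; elim: k => [|k IH]; first by rewrite scale0r; exact: rot_realizable0.
rewrite -natr1 scalerDl scale1r; apply: rot_realizableD => //.
exists (delta_mx c c); split=> [i j|i|]; first by rewrite mxE natr_nat.
- exact: delta_row_sum.
- by rewrite rot90_delta cc.
Qed.

Lemma rot_realizable_seq (l : seq 'I_n) : ~~ odd (size l) ->
  rot_realizable (\sum_(x <- l) (delta_mx 0 x + delta_mx 0 (rev_ord x))).
Proof.
have [k] := ubnP (size l); elim: k l => // k IH [|x [|y l]] //= kl.
  by rewrite big_nil => _; exact: rot_realizable0.
rewrite negbK => le; rewrite !big_cons addrA.
by apply: rot_realizableD; [exact: rot_realizable_orbit | apply: IH => //; lia].
Qed.

(** Its length is the sum in condition (c), so that condition says whether the list can be cut into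
    pairs. *)
Definition half_seq (f : 'I_n -> nat) : seq 'I_n :=
  flatten [seq nseq (f x) x | x <- enum 'I_n & (x < n./2)%N].

Lemma sum_half_seq (V : nmodType) (f : 'I_n -> nat) (g : 'I_n -> V) :
  \sum_(x <- half_seq f) g x = \sum_(x < n | (x < n./2)%N) g x *+ f x.
Proof.
rewrite /half_seq big_flatten big_map big_filter big_enum_cond /=.
by apply: eq_bigr => x _; rewrite big_nseq -Monoid.iteropE; case: (f x).
Qed.

Lemma size_half_seq (f : 'I_n -> nat) :
  size (half_seq f) = (\sum_(x < n | (x < n./2)%N) f x)%N.
Proof.
rewrite -sum1_size; apply: etrans (sum_half_seq f (fun=> 1%N)) _.
by apply: eq_bigr => x _; rewrite -[f x in RHS]natn.
Qed.

Lemma palindromic_decomp r : palindromic r ->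
  r = \sum_(x < n | (x < n./2)%N) r 0 x *: (delta_mx 0 x + delta_mx 0 (rev_ord x))
      + \sum_(x | rev_ord x == x) r 0 x *: delta_mx 0 x.
Proof.
move=> pr; rewrite [LHS]row_sum_delta sum_rev_split; congr (_ + _).
by apply: eq_bigr => i _; rewrite -pr scalerDr.
Qed.

Lemma sum_half_seq_delta r (f : 'I_n -> nat) (rf : forall i, r 0 i = (f i)%:R) :
  \sum_(x < n | (x < n./2)%N) r 0 x *: (delta_mx 0 x + delta_mx 0 (rev_ord x) : 'rV[K]_n)
  = \sum_(x <- half_seq f) (delta_mx 0 x + delta_mx 0 (rev_ord x)).
Proof. by rewrite sum_half_seq; apply: eq_bigr => x _; rewrite rf scaler_nat. Qed.

End RotationInvariant.

Lemma is_even_natr (K : realType) (k : nat) : is_even (k%:R : K) -> ~~ odd k.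
Proof. by move=> [m]; rewrite -[k%:R]/((k%:Z)%:~R) => /intr_inj; lia. Qed.

Lemma is_even_mulr2n (K : realType) (x : K) :
  x \is a Num.int -> is_even (x *+ 2).
Proof. by move=> /intrP[m ->]; exists m; rewrite intrM mulr_natl. Qed.

Lemma rot_realizable_even (K : realType) (n : nat) (r : 'rV[K]_n)
    (f : 'I_n -> nat) : (forall i, r 0 i = (f i)%:R) -> palindromic r ->
  ~~ odd (size (half_seq f)) -> rot_realizable r.
Proof.
move=> rf pr er; rewrite (palindromic_decomp pr) (sum_half_seq_delta rf).
apply: rot_realizableD; first exact: rot_realizable_seq.
elim/big_ind: _ => [|u v|c cc]; first exact: rot_realizable0.
- exact: rot_realizableD.
- by rewrite rf; exact: rot_realizable_center.
Qed.

Lemma rot_realizable_center_ge2 (K : realType) (n : nat) (r : 'rV[K]_n)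
    (f : 'I_n -> nat) (c : 'I_n) : (forall i, r 0 i = (f i)%:R) ->
  palindromic r -> rev_ord c == c -> 2 <= r 0 c ->
  odd (size (half_seq f)) -> rot_realizable r.
Proof.
move=> rf pr cc; rewrite rf ler_nat => c2 ol.
rewrite (palindromic_decomp pr) (sum_half_seq_delta rf).
rewrite [X in _ + X](big_pred1 c); last by move=> i; exact: rev_ord_fixed_unique.
rewrite rf -(subnK c2) natrD scalerDl addrCA; apply: rot_realizableD.
  exact: rot_realizable_center.
(* The two units set aside from [f c] are what [c], being its own reflection, contributes as a new
   head of the list, whose length becomes even. *)
rewrite scaler_nat mulr2n -{2}(eqP cc) addrC.
by have := @rot_realizable_seq K n (c :: half_seq f); rewrite big_cons; apply; rewrite /= ol.
Qed.

(** Invariance gives [A i (rev_ord j) = A j i], so the upper right quadrant has the same sum as the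
    upper left one. *)
Lemma rot_half_sum (K : realType) (n : nat) (A : 'M[K]_n) : rot90 A = A ->
  \sum_(i < n | (i < n./2)%N) \sum_j A i j
  = (\sum_(i < n | (i < n./2)%N) \sum_(j < n | (j < n./2)%N) A i j) *+ 2
    + \sum_(c | rev_ord c == c) \sum_(i < n | (i < n./2)%N) A i c.
Proof.
move=> rA; under eq_bigr => i _ do rewrite sum_rev_split big_split /=.
rewrite !big_split /= mulr2n; congr (_ + _ + _); last exact: exchange_big.
by rewrite exchange_big; do 2![apply: eq_bigr => ? _]; rewrite rot90_fixedE.
Qed.

(** Both halves of the middle row are rotated copies of the upper half of the middle column. *)
Lemma rot_center_row_sum (K : realType) (n : nat) (A : 'M[K]_n) (c : 'I_n) :
  rot90 A = A -> rev_ord c == c ->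
  \sum_j A c j = (\sum_(i < n | (i < n./2)%N) A i c) *+ 2 + A c c.
Proof.
move=> rA cc; rewrite sum_rev_split [X in _ + X](big_pred1 c) => [|i].
  rewrite -sumrMnl; congr (_ + _). apply: eq_bigr => i _.
  by rewrite rot90_fixedE // -(rot90_fixedE c i rA) (eqP cc) mulr2n.
exact: rev_ord_fixed_unique.
Qed.

Theorem theorem15 (K : realType) (n : nat) (hn : (1 <= n)%N)
    (r s : 'rV[K]_n)
    (hr : forall i, 0 <= r 0 i) (hs : forall j, 0 <= s 0 j)
    (hrs : \sum_i r 0 i = \sum_j s 0 j) :
  (transport_rot r s !=set0 <-> r = s /\ palindromic r)
  /\
  ((forall i, r 0 i \is a Num.nat) -> (forall j, s 0 j \is a Num.nat) ->
   (transport_rot_int r s !=set0 <->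
    [/\ r = s, palindromic r
      & is_even (\sum_(i < n | (i < n./2)%N) r 0 i) \/
        (odd n /\ exists2 i : 'I_n, i.+1 = uphalf n & 2 <= r 0 i)])).
Proof.
have nec A : transport_rot r s A -> r = s /\ palindromic r.
  move=> [[_ Ar As] rA]; split=> [|i]; last by rewrite -!Ar rot90_row_sum_rev.
  by apply/rowP=> i; rewrite -Ar -As rot90_col_sum.
split.
  split=> [[A /nec]//|[<- pr]].
  (* At the centre both indicators are 1, so that entry is the whole of the middle component of
     [r]. *)
  exists (\matrix_(i, j) (r 0 i / 2 * ((i == j)%:R + (i == rev_ord j)%:R))).
  set A := (X in _ X).
  have rA : rot90 A = A.
    apply/matrixP=> i j; rewrite !mxE rev_ordK.
    have -> : (j == rev_ord i) = (i == rev_ord j).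
      by rewrite -(inj_eq rev_ord_inj) rev_ordK eq_sym.
    (* Rotation swaps the two indicators and replaces [r 0 i] by [r 0 j]; off the diagonal this
       matters only for [i = rev_ord j], where palindromicity applies. *)
    rewrite (eq_sym j i); have [->|_] := eqVneq i j; first by rewrite addrC.
    by have [->|_] := eqVneq i (rev_ord j); rewrite -?pr ?addr0 ?add0r ?mulr0.
  have Ar i : \sum_j A i j = r 0 i.
    under eq_bigr => j _ do rewrite mxE.
    rewrite -mulr_sumr big_split /= (bigD1 i) //= eqxx big1 => [|j /negPf].
      rewrite (bigD1 (rev_ord i)) //= rev_ordK eqxx big1 => [|j /negPf ji].
        by rewrite !addr0; lra.
      by rewrite -(inj_eq rev_ord_inj) rev_ordK eq_sym ji.
    by rewrite eq_sym => ->.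
  split=> //; split=> // [i j|j].
    by rewrite mxE mulr_ge0 ?divr_ge0 ?addr_ge0.
  by rewrite rot90_col_sum.
move=> rn _; split=> [[A [tA Ai]]|[<- pr cd]].
  have [rs pr] := nec A tA; split=> //; case: tA => [[A0 Ar _] rA].
  (* The parity of [n] enters as the existence of a fixed point of [rev_ord]. *)
  case: (pickP (fun c : 'I_n => rev_ord c == c)) => [c cc|no_c]; last first.
    left; under eq_bigr => i _ do rewrite -Ar.
    rewrite rot_half_sum // [X in _ + X]big_pred0 // addr0.
    by apply: is_even_mulr2n; do 2![apply: rpred_sum => ? _].
  pose t := \sum_(i < n | (i < n./2)%N) A i c.
  have tn : t \is a Num.nat.
    by rewrite natrEint sumr_ge0 // andbT; apply: rpred_sum.
  have [t0|t_neq0] := eqVneq t 0.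
    left; under eq_bigr => i _ do rewrite -Ar.
    rewrite rot_half_sum // [X in _ + X](big_pred1 c); last by move=> i; exact: rev_ord_fixed_unique.
    rewrite -/t t0 addr0.
    by apply: is_even_mulr2n; do 2![apply: rpred_sum => ? _].
  move: (cc); rewrite rev_ord_fixedE => /andP[on /eqP cn].
  right; split=> //; exists c => //.
  rewrite -Ar rot_center_row_sum // -/t.
  have t1 : 1 <= t by case/natrP: tn t_neq0 => -[|k] ->; rewrite ?eqxx // ler1n.
  by have := A0 c c; lra.
have [f rf] : exists f : 'I_n -> nat, forall i, r 0 i = (f i)%:R.
  by exists (fun i => Num.truncn (r 0 i)) => i; rewrite truncnK.
suff [A [An Ar rA]] : rot_realizable r.
  exists A; split=> [|i j]; last exact: intr_nat.
  split=> //; split=> // [i j|j]; first exact: natr_ge0.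
  by rewrite rot90_col_sum.
have [ol|el] := boolP (odd (size (half_seq f))); last exact: rot_realizable_even el.
case: cd => [er|[on [c cn c2]]].
  (* Condition (c) contradicts the odd length of the list. *)
  suff /is_even_natr : is_even ((size (half_seq f))%:R : K) by rewrite ol.
  by rewrite size_half_seq natr_sum; under eq_bigr => i _ do rewrite -rf.
by apply: rot_realizable_center_ge2 c2 ol => //; rewrite rev_ord_fixedE on cn eqxx.
Qed.
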